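(* Let $\mu$ be any vertex of $\Gamma$ and let $\xi>0$ be a rational number. Then $\xi\in\mathcal H^{\mathfrak a}_\mu$ if and only if $$ h^{\mathfrak a}_\mu(\xi):=d_\mu\xi+(v_\Gamma(\mu)-2)V_{\mu,\mu}-\sum_{\nu\sim\mu}s^\mu_\nu\left\lceil\sum_{i\in\Gamma^\mu_\nu}\frac{\widehat d_iV_{\mu,i}}{s^\mu_\nu}\,\xi\right\rceil^{+}\in S^\mu . $$ Equivalently, $$ \mathcal H^{\mathfrak a}_\mu=\left\{\frac{t}{d_\mu}\;\middle|\; t+(v_\Gamma(\mu)-2)V_{\mu,\mu}-\sum_{\nu\sim\mu}s^\mu_\nu\left\lceil t\sum_{i\in\Gamma^\mu_\nu}\frac{\widehat d_iV_{\mu,i}}{s^\mu_\nu d_\mu}\right\rceil^{+}\in S^\mu\right\}. $$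
   Context: Setting: $R$ is a two-dimensional regular local ring with algebraically closed residue field and $\mathfrak a\subset R$ is a proper nonzero complete ideal of finite colength. Let $\pi:X=X_{N+1}\to X_N\to\cdots\to X_1=\operatorname{Spec}R$ be a composition of blowups $\pi_\mu:X_{\mu+1}\to X_\mu$ at closed points $x_\mu\in X_\mu$ such that $\mathfrak a\mathcal O_X=\mathcal O_X(-D)$ is invertible. $E_\mu$ (resp. $E^*_\mu$) denotes the strict (resp. total) transform on $X$ of $\pi_\mu^{-1}(x_\mu)$. We write $\mu\succ\nu$ ($x_\mu$ proximate to $x_\nu$) if $x_\mu$ lies on the strict transform on $X_\mu$ of $\pi_\nu^{-1}(x_\nu)$. The proximity matrix $P=(p_{\mu,\nu})$ has $p_{\mu,\mu}=1$, $p_{\mu,\nu}=-1$ if $\mu\succ\nu$, and $0$ otherwise; $Q=(q_{\mu,\nu})=P^{-1}$. Let $\{\widehat E_\nu\}$ be the basis of $\bigoplus_\nu\mathbb Q E_\nu$ dual to $\{E_\nu\}$ in the sense $E_\mu\cdot\widehat E_\nu=-\delta_{\mu,\nu}$, and $\mathfrak p_\nu\subset R$ the simple complete ideal with $\mathfrak p_\nu\mathcal O_X=\mathcal O_X(-\widehat E_\nu)$. The valuation matrix is $V=(P^{T}P)^{-1}$; it is symmetric with $V_{\mu,\nu}=v_\mu(\mathfrak p_\nu)$, where $v_\mu$ is the $\mathfrak m_{X_\mu,x_\mu}$-adic order valuation. For a divisor $G=\sum_\nu g_\nu E_\nu=\sum_\nu\widehat g_\nu\widehat E_\nu$ we have $g=\widehat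 gV$; $G$ is antinef if $\widehat g_\nu\ge0$ for all $\nu$. Write $\mathfrak a=\prod_\nu\mathfrak p_\nu^{\widehat d_\nu}$ and $D=\sum d_\nu E_\nu=\sum\widehat d_\nu\widehat E_\nu$. The canonical divisor is $K=\sum_\nu E^*_\nu=\sum_\nu k_\nu E_\nu$ with $k_\nu=\sum_\mu q_{\nu,\mu}$. Dual graph $\Gamma$: vertices $1,\dots,N$, with $\gamma\sim\eta$ (adjacent) iff $\gamma\neq\eta$ and $E_\gamma\cap E_\eta\neq\emptyset$; it is a tree. $v_\Gamma(\mu)$ is the number of vertices adjacent to $\mu$. For vertices $\mu,\nu$, the branch $\Gamma^\mu_\nu$ is the maximal connected subgraph of $\Gamma$ containing $\nu$ but not $\mu$ ($\Gamma^\mu_\mu=\emptyset$). Jumping numbers: for $F=\sum f_\nu E_\nu$, $G=\sum g_\nu E_\nu$ and a vertex $\nu$ put $\lambda(F,G;\nu)=(f_\nu+k_\nu+1)/g_\nu$. For an antinef $F$ with integer coefficients put $\xi_F=\min_\nu\lambda(F,D;\nu)$ (the jumping numbers of $\mathfrak a$ are exactly these numbers $\xi_F$). Define $\mathcal H^{\mathfrak a}_\mu=\{\xi_F\mid F\text{ antinef with integer coefficients},\ \xi_F=\lambda(F,D;\mu)\}$, the jumping numbers supported at $\mu$. Semigroups: $\mathcal{SV}^\mu_\nu$ is the submonoid of $\mathbb N$ generated by $\{V_{\mu,i}\mid i\in\Gamma^\mu_\nu\cup\{\mu\}\}$, $s^\mu_\nu=\gcd\mathcal{SV}^\mu_\nu$,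 and $S^\mu$ is the submonoid of $\mathbb N$ generated by $\{s^\mu_\nu\mid\nu\in\Gamma\}$ (so $S^\mu=\mathbb N$ if $\mu$ is the only vertex). $\lceil x\rceil^{+}$ denotes rounding $x$ up to the nearest positive integer, i.e. $\max(1,\lceil x\rceil)$. *)

(* Defs.v *)
From HB Require Import structures.
From mathcomp Require Import all_boot all_order all_algebra.
Set Implicit Arguments. Unset Strict Implicit. Unset Printing Implicit Defensive.
Import Order.TTheory GRing.Theory Num.Theory.

(* Combinatorial model of a sequence of point blowups over a 2-dim regular   *)
(* local ring with algebraically closed residue field.                       *)
(* Vertices are 0-based: vertex k (0 <= k < N) is the k-th blowup, i.e. the  *)
(* paper's index k+1.  Vertex 0 is the blowup of the closed point.  For      *)
(* k >= 1 the point x_k is described by the (k-1)-th entry of s : seq bstep: *)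
(*   Free a   : x_k is a free point, lying only on (the strict transform of) *)
(*              E_a (a < k);                                                 *)
(*   Sat a c  : x_k is the satellite point E_a /\ E_c (a, c < k, adjacent).  *)
Inductive bstep := Free of nat | Sat of nat & nat.

Definition upd (m : nat) (g : rel nat) (b : bstep) : rel nat :=
  match b with
  | Free a => fun x y => [|| g x y, (x == m) && (y == a) | (x == a) && (y == m)]
  | Sat a c => fun x y =>
      [|| g x y && ~~ (((x == a) && (y == c)) || ((x == c) && (y == a))),
          (x == m) && ((y == a) || (y == c))
        | ((x == a) || (x == c)) && (y == m)]
  end.

(* Dual graph of the exceptional divisor after the blowups 0..k. *)
Fixpoint graph_upto (s : seq bstep) (k : nat) : rel nat :=
  match k with
  | 0 => fun _ _ => false
  | k'.+1 => upd k (graph_upto s k') (nth (Free 0) s k')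
  end.

Definition valid_step (m : nat) (g : rel nat) (b : bstep) : bool :=
  match b with
  | Free a => a < m
  | Sat a c => [&& a < m, c < m, a != c & g a c]
  end.

Definition valid (s : seq bstep) : bool :=
  all (fun k => valid_step k.+1 (graph_upto s k) (nth (Free 0) s k)) (iota 0 (size s)).

(* proximity: i >- j  iff  x_i lies on the strict transform of E_j on X_i. *)
Definition prox (s : seq bstep) (i j : nat) : bool :=
  match i with
  | 0 => false
  | i'.+1 => match nth (Free 0) s i' with
             | Free a => j == a
             | Sat a c => (j == a) || (j == c)
             end
  end.

Local Open Scope ring_scope.

Section Data.
Variables (N : nat) (s : seq bstep).

Definition Pmx : 'M[rat]_N :=
  \matrix_(i, j) (if i == j then 1 else if prox s i j then -1 else 0).
Definition Qmx : 'M[rat]_N := invmx Pmx.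
Definition Vmx : 'M[rat]_N := invmx (Pmx^T *m Pmx).

(* canonical divisor coefficients k_nu = sum_mu q_{nu,mu} *)
Definition kcoef (nu : 'I_N) : rat := \sum_(m < N) Qmx nu m.

Definition adj (i j : 'I_N) : bool := (i != j) && graph_upto s N.-1 i j.
Definition valence (mu : 'I_N) : nat := #|[set j | adj mu j]|.

Definition branch (mu nu : 'I_N) : {set 'I_N} :=
  if nu == mu then set0
  else [set i | connect [rel x y | [&& adj x y, x != mu & y != mu]] nu i].

(* V_{mu,i} as a natural number (V has positive integer entries) *)
Definition Vnat (mu i : 'I_N) : nat := absz (numq (Vmx mu i)).

Definition sgen (mu nu : 'I_N) : nat :=
  \big[gcdn/0%N]_(i in branch mu nu :|: [set mu]) Vnat mu i.

Definition in_S (mu : 'I_N) (n : nat) : Prop :=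
  exists c : 'I_N -> nat, n = (\sum_(nu < N) c nu * sgen mu nu)%N.

Variable dhat : 'I_N -> nat.

(* D = sum dhat_nu Ehat_nu = sum d_nu E_nu, d = dhat V *)
Definition dcoef (nu : 'I_N) : rat := \sum_(i < N) (dhat i)%:R * Vmx i nu.

(* F = sum f_nu E_nu; fhat = f V^-1 *)
Definition fhat (f : 'I_N -> rat) (nu : 'I_N) : rat :=
  \sum_(i < N) f i * (invmx Vmx) i nu.
Definition antinef_int (f : 'I_N -> rat) : Prop :=
  (forall nu, f nu \is a Num.int) /\ (forall nu, 0 <= fhat f nu).

Definition lam (f : 'I_N -> rat) (nu : 'I_N) : rat :=
  (f nu + kcoef nu + 1) / dcoef nu.

Definition jumping_at (mu : 'I_N) (xi : rat) : Prop :=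
  exists f, antinef_int f /\ xi = lam f mu /\ (forall nu, lam f mu <= lam f nu).

Definition ceilp (x : rat) : int := Order.max 1 (Num.ceil x).

Definition hfun (mu : 'I_N) (xi : rat) : rat :=
  dcoef mu * xi + ((valence mu)%:R - 2) * Vmx mu mu
  - \sum_(nu < N | adj mu nu)
      (sgen mu nu)%:R *
      (ceilp ((\sum_(i in branch mu nu) (dhat i)%:R * Vmx mu i) / (sgen mu nu)%:R * xi))%:~R.

End Data.

(* Main.v *)
Require Import Defs.
From HB Require Import structures.
From mathcomp Require Import all_boot all_order all_algebra.
From mathcomp Require Import ring lra.
Set Implicit Arguments. Unset Strict Implicit. Unset Printing Implicit Defensive.
Import Order.TTheory GRing.Theory Num.Theory.
Local Open Scope ring_scope.

(** Let M = P^T P = V^-1, which has off-diagonal entries -1 on the edges of the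
    tree and 0 elsewhere, and is positive definite and unimodular. Writing
    a = f + k + 1, adjunction gives a M = fhat + 2 - v_Gamma, so xi is supported at
    mu iff some integral vector a satisfies a >= xi d, a M >= 2 - v_Gamma and
    a_mu = xi d_mu. The contribution of the branch at a neighbour v of mu to
    a_mu = sum_i (a M)_i V_{i,mu} is V_{mu,mu} a_v - V_{mu,v} a_mu; it is a multiple
    of s^mu_v, at least xi times the same quantity for d, and positive. This yields
    the membership in S^mu. Conversely, any values of these contributions meeting
    the three conditions and adding up correctly are realised by a vector a built
    outwards from mu along the tree. Both positivity and the integrality of a_v
    rest on unimodularity, in the form: for neighbours v' <> v of mu, V_{mu,mu}
    divides (V_{mu,v} + 1) s^mu_v and V_{mu,v} s^mu_v'. *)

Lemma rat_int_lt (x y : rat) :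
  x \is a Num.int -> y \is a Num.int -> (x < y) = (x + 1 <= y).
Proof.
by move=> /intrP[m ->] /intrP[n ->]; rewrite ltr_int -lezD1 -(ler_int rat) intrD.
Qed.

(** * Branches of a tree *)

Lemma connect_ind (T : finType) (P : pred T) (e : rel T) x y :
  (forall a b, e a b -> P a -> P b) -> P x -> connect e x y -> P y.
Proof.
move=> step Px /connectP[q]; elim: q x Px => [|z q IHq] x Px /= => [_ -> //|].
by case/andP=> xz zq yq; apply: (IHq z _ zq yq); apply: step Px.
Qed.

Section Tree.

Variables (T : finType) (adj : rel T).

Definition branch_of (p v : T) : {set T} :=
  if v == p then set0
  else [set i | connect [rel x y | [&& adj x y, x != p & y != p]] v i].

Hypothesis adjC : symmetric adj.
Hypothesis adj_irr : irreflexive adj.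
Hypothesis adj_connected : forall C : {set T},
  (forall x y, adj x y -> x \in C -> y \in C) ->
  forall x y, x \in C -> y \in C.
Hypothesis adj_bridge : forall x y, adj x y -> exists C : {set T},
  [/\ x \in C, y \notin C &
      forall u v, adj u v -> u \in C -> v \notin C -> u = x /\ v = y].

Lemma adj_neq x y : adj x y -> x != y.
Proof. by apply: contraTneq => ->; rewrite adj_irr. Qed.

Lemma branch_neq p v x : x \in branch_of p v -> x != p.
Proof.
rewrite /branch_of; case: eqVneq => [_|vp]; first by rewrite inE.
by rewrite inE; apply: (@connect_ind _ (predC1 p)) => // a b /and3P[].
Qed.

Lemma branch_rootN p v : p \notin branch_of p v.
Proof. by apply/negP=> /branch_neq; rewrite eqxx. Qed.

Lemma branch_root p v : v != p -> v \in branch_of p v.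
Proof. by move=> /negPf vp; rewrite /branch_of vp inE connect0. Qed.

Lemma branch_step p v x y :
  adj x y -> y != p -> x \in branch_of p v -> y \in branch_of p v.
Proof.
move=> xy yp xB; move: (branch_neq xB) (xB) => xp.
rewrite /branch_of; case: eqP => _; first by rewrite inE.
rewrite !inE => /connect_trans; apply; apply: connect1 => /=.
by rewrite xy xp.
Qed.

(** A step that avoids [p] stays in the branch, so the exit lands on [p]. The branch lies in the
    side of the bridge [v p] containing [v], since the only edge leaving that side ends at [p]. *)
Lemma branch_exit p v x y : adj v p ->
  x \in branch_of p v -> y \notin branch_of p v -> adj x y -> x = v /\ y = p.
Proof.
move=> vp xB yB xy.
have yE : y = p.
  by apply/eqP; apply: contraNT yB => yp; apply: branch_step xB.
rewrite yE in xy *.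
have [C [vC pC exitC]] := adj_bridge vp.
suff xC : x \in C by split=> //; case: (exitC x p xy xC pC).
move: xB; rewrite /branch_of (negPf (adj_neq vp)) inE.
apply: (@connect_ind _ (mem C)) => // a b /and3P[ab _ bp] aC; apply: contraT => bC.
by have [_ bpE] := exitC a b ab aC bC; rewrite bpE eqxx in bp.
Qed.

Lemma branch_eq p v i : i \in branch_of p v -> branch_of p i = branch_of p v.
Proof.
move=> iB; have ip := branch_neq iB.
move: iB; rewrite /branch_of (negPf ip); case: eqVneq => [_|vp]; rewrite inE //.
move=> vi; apply/setP=> j; rewrite !inE; apply/esym.
apply: same_connect vi j; apply: sym_connect_sym => x y /=.
by rewrite adjC; congr andb; rewrite andbC.
Qed.

Lemma branch_cover p i : i != p -> exists2 v, adj p v & i \in branch_of p v.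
Proof.
pose C := [set i | (i == p) || [exists v, adj p v && (i \in branch_of p v)]].
have pC : p \in C by rewrite inE eqxx.
have /adj_connected/(_ p i pC) : forall x y, adj x y -> x \in C -> y \in C.
  move=> x y xy; rewrite !inE; case: (eqVneq y p) => //= yp.
  case/predU1P=> [xE|/existsP[v /andP[pv xB]]]; apply/existsP.
    by exists y; rewrite -xE xy branch_root // eq_sym adj_neq // -xE.
  by exists v; rewrite pv (branch_step xy).
rewrite inE => /predU1P[-> /eqP//|/existsP[v /andP[pv iB]] _].
by exists v.
Qed.

Lemma branch_inj p v v' i : adj p v -> adj p v' ->
  i \in branch_of p v -> i \in branch_of p v' -> v = v'.
Proof.
move=> pv pv' /branch_eq Ev /branch_eq; rewrite Ev => EB.
have v'B : v' \in branch_of p v.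
  by rewrite EB branch_root // eq_sym adj_neq.
by have [] := @branch_exit p v v' p;
  rewrite ?branch_rootN // adjC.
Qed.

(** The two branches at the ends of an edge are disjoint by [branch_exit], and their union is closed
    under adjacency, hence everything. *)
Lemma branch_compl p v i : adj p v ->
  (i \in branch_of v p) = (i \notin branch_of p v).
Proof.
move=> pv; have vp : adj v p by rewrite adjC.
have pNv := adj_neq pv; have vNp := adj_neq vp.
apply/idP/idP.
  rewrite /branch_of (negPf pNv) inE.
  apply: (@connect_ind _ [pred j | j \notin branch_of p v]).
    move=> a b /= /and3P[ab av bv]; apply: contra => bB; apply: contraT => aB.
  by have [bE _] := branch_exit vp bB aB (etrans (adjC _ _) ab); rewrite bE eqxx in bv.
  exact: branch_rootN.
pose C := branch_of v p :|: branch_of p v.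
suff : i \in C by rewrite inE => /orP[//|->].
apply: (@adj_connected C _ p); last by rewrite inE branch_root.
move=> x y xy; rewrite !inE => /orP[xB|xB].
  case: (eqVneq y v) => [->|yv]; first by rewrite branch_root ?orbT.
  by rewrite (branch_step xy yv xB).
case: (eqVneq y p) => [->|yp]; first by rewrite branch_root.
by rewrite (branch_step xy yp xB) orbT.
Qed.

Lemma branch_sub p v i : adj p v -> adj v i -> i != p ->
  branch_of v i \subset branch_of p v.
Proof.
move=> pv vi ip; apply/subsetP=> x xB; apply: contraT.
rewrite -branch_compl // => xB'; case/eqP: ip.
by apply: branch_inj vi _ xB xB'; rewrite adjC.
Qed.

Lemma branch_card_lt p v i : adj p v -> adj v i -> i != p ->
  (#|branch_of v i| < #|branch_of p v|)%N.
Proof.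
move=> pv vi ip; apply: proper_card; apply/properP; split.
  exact: branch_sub.
by exists v; rewrite ?branch_rootN // branch_root // eq_sym adj_neq.
Qed.

Lemma sum_branch (W : nmodType) (F : T -> W) p :
  \sum_i F i = F p + \sum_(v | adj p v) \sum_(i in branch_of p v) F i.
Proof.
rewrite (bigD1 p) //=; congr (_ + _).
rewrite (exchange_big_dep (predC1 p)) /=; last first.
  by move=> v i _ /branch_neq.
apply: eq_bigr => i /branch_cover[v pv iB].
rewrite (big_pred1 v) // => u; apply/andP/eqP => [[pu iB']|-> //].
exact: branch_inj pu pv iB' iB.
Qed.

Lemma branch_glue (R : Type) p (x : R) (f : T -> T -> R) :
  (forall v, adj p v -> f v p = x) ->
  exists a : T -> R, a p = x /\
    (forall v j, adj p v -> j \in p |: branch_of p v -> a j = f v j).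
Proof.
move=> fp.
(* By [branch_cover] only [p] itself receives the default [x]. *)
exists (fun j => if [pick v | adj p v && (j \in branch_of p v)] is Some v
                 then f v j else x).
split=> [|v j pv].
  by case: pickP => // v /andP[_]; rewrite (negPf (branch_rootN _ _)).
rewrite in_setU1; case/predU1P=> [->|jB]; case: pickP => //.
- by move=> u /andP[_]; rewrite (negPf (branch_rootN _ _)).
- by move=> _; rewrite fp.
- by move=> u /andP[pu jB']; rewrite (branch_inj pu pv jB' jB).
- by move=> /(_ v); rewrite pv jB.
Qed.

(** * Unimodular weighted trees *)

Variables (w : T -> rat) (V : T -> T -> rat).

(** The row vector [a] times the matrix M: minus the intersection number with the j-th component,
    [w j] being minus its self-intersection. *)
Definition lap (a : T -> rat) (j : T) : rat := w j * a j - \sum_(l | adj j l) a l.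

Hypothesis w_int : forall i, w i \is a Num.int.
Hypothesis V_int : forall i j, V i j \is a Num.int.
Hypothesis V_gt0 : forall i j, 0 < V i j.
Hypothesis VC : forall i j, V i j = V j i.
Hypothesis lapV : forall i j, lap (V j) i = (i == j)%:R.
(** This termwise form of definiteness applies directly to a vector that is zero outside a set and
    has [lap] zero inside it. *)
Hypothesis lap_definite : forall a, (forall j, a j * lap a j = 0) -> forall j, a j = 0.

Let V_neq0 i j : V i j != 0.
Proof. by rewrite gt_eqF. Qed.

Lemma eq_lap a b j : a =1 b -> lap a j = lap b j.
Proof. by move=> ab; rewrite /lap ab; congr (_ - _); apply: eq_bigr. Qed.

Lemma lap_linear c a e b j :
  lap (fun l => c * a l + e * b l) j = c * lap a j + e * lap b j.
Proof. by rewrite /lap big_split -!mulr_sumr /=; ring. Qed.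

Lemma lap_sum (I : finType) (c : I -> rat) (a : I -> T -> rat) j :
  lap (fun l => \sum_i c i * a i l) j = \sum_i c i * lap (a i) j.
Proof.
rewrite /lap exchange_big /= mulr_sumr -sumrB; apply: eq_bigr => i _.
by rewrite -mulr_sumr; ring.
Qed.

Lemma lapK a j : a j = \sum_l lap a l * V l j.
Proof.
pose b i := 1 * a i + (-1) * \sum_l lap a l * V l i.
suff /(_ j) : forall i, b i = 0 by rewrite /b; lra.
apply: lap_definite => i; rewrite lap_linear lap_sum.
rewrite (bigD1 i) //= lapV eqxx big1 => [|l li] /=; first by ring.
by rewrite lapV eq_sym (negPf li) mulr0.
Qed.

Lemma eq_lap_branch p v a b j : adj p v -> j \in branch_of p v ->
  (forall l, l \in p |: branch_of p v -> a l = b l) -> lap a j = lap b j.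
Proof.
move=> pv jB ab; rewrite /lap ab; last by rewrite in_setU1 jB orbT.
congr (_ - _); apply: eq_bigr => l jl; apply: ab; rewrite in_setU1.
by case: eqVneq => //= lp; apply: branch_step jB.
Qed.

(* Positive definiteness, applied to z cut off outside the branch. *)
Lemma lap_branch_inj p v z : adj p v -> z p = 0 ->
  (forall j, j \in branch_of p v -> lap z j = 0) ->
  forall j, j \in branch_of p v -> z j = 0.
Proof.
move=> pv zp Lz j jB; pose y l := if l \in branch_of p v then z l else 0.
suff : y j = 0 by rewrite /y jB.
apply: lap_definite => l; rewrite {1}/y; case: ifP => lB; rewrite ?mul0r //.
rewrite (@eq_lap_branch p v y z) ?Lz ?mulr0 // => i.
rewrite in_setU1 /y; case: ifP => // iB; rewrite orbF => /eqP ->.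
by rewrite zp.
Qed.

(** As functions of [j] both sides agree at [p], and both have [lap] zero on the branch, because [l]
    and [p] lie outside it. *)
Lemma V_across p v j l : adj p v -> j \in branch_of p v ->
  l \notin branch_of p v -> V p p * V j l = V p j * V p l.
Proof.
move=> pv jB lB; suff : V p p * V l j + (- V p l) * V p j = 0.
  by rewrite (VC l j); lra.
apply: (@lap_branch_inj p v (fun i => V p p * V l i + (- V p l) * V p i)) => //.
  by rewrite (VC l p); ring.
move=> i iB; rewrite lap_linear !lapV (negPf (branch_neq iB)).
by case: eqVneq iB => [->|_]; rewrite ?(negPf lB) // !mulr0 addr0.
Qed.

Lemma lap_delta p i : i != p -> lap (fun l => (l == p)%:R) i = - (adj i p)%:R.
Proof.
move=> /negPf ip; rewrite /lap ip mulr0 sub0r; congr (- _).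
under eq_bigr => l _ do rewrite -[_%:R]mulr1 mulr_natl mulrb.
by rewrite -big_mkcondr big_mkcond (bigD1 p) //= eqxx andbT big1 ?addr0;
  [case: (adj i p) | move=> l /negPf ->; rewrite andbF].
Qed.

Lemma V_along p v j : adj p v -> j \in branch_of p v ->
  (V p v + 1) * V p j = V p p * V v j.
Proof.
move=> pv jB; have vp : adj v p by rewrite adjC.
(* The delta term makes [z] vanish at [p]. On the branch its [lap] is [- V p p] at [v] alone,
   cancelling that of [V p p * V v i]. *)
pose z i := 1 * (V p p * V v i + (- V p v - 1) * V p i) + V p p * (i == p)%:R.
suff : z j = 0 by rewrite /z (negPf (branch_neq jB)) /=; lra.
apply: (lap_branch_inj pv _ _ jB) => [|i iB].
  by rewrite /z eqxx (VC v p) /=; ring.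
have ip := branch_neq iB.
have -> : lap z i = V p p * ((i == v)%:R - (adj i p)%:R).
  rewrite lap_linear lap_linear !lapV lap_delta // (negPf ip) /=; ring.
have -> : adj i p = (i == v); last by rewrite subrr mulr0.
apply/idP/eqP => [ip'|-> //].
by have [] := branch_exit vp iB (branch_rootN p v) ip'.
Qed.

Lemma V_edge p v : adj p v -> (V p v + 1) * V p v = V p p * V v v.
Proof. by move=> pv; apply: V_along; rewrite // branch_root // eq_sym adj_neq. Qed.

(* By [lapK] and [flowE], the share of the branch at v in a p. *)
Definition flow (a : T -> rat) (p v : T) : rat := V p p * a v - V p v * a p.

Lemma flow_linear c a e b p v :
  flow (fun l => c * a l + e * b l) p v = c * flow a p v + e * flow b p v.
Proof. by rewrite /flow; ring. Qed.

(** Expand [a v] and [a p] by [lapK]: the coefficient of [lap a j] is [V p j] on the branch by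
    [V_along] and 0 off it by [V_across]. *)
Lemma flowE a p v : adj p v -> flow a p v = \sum_(j in branch_of p v) lap a j * V p j.
Proof.
move=> pv; rewrite /flow {1}(lapK a v) {1}(lapK a p) !mulr_sumr -sumrB.
rewrite [RHS]big_mkcond /=; apply: eq_bigr => j _.
have vB : v \in branch_of p v by rewrite branch_root // eq_sym adj_neq.
case: ifP => jB.
  by rewrite (VC j v) (VC j p) mulrCA -(V_along pv jB); ring.
by rewrite (VC j v) (VC j p) mulrCA (V_across pv vB) ?jB //; ring.
Qed.

(** The coefficients of [a v] combine through the diagonal entry of M V = 1. *)
Lemma lap_node a v :
  V v v * lap a v + \sum_(i | adj v i) flow a v i = a v.
Proof.
rewrite /flow sumrB -mulr_sumr -mulr_suml.
by have := lapV v v; rewrite eqxx /lap /= => /(canRL (subrK _)) E; ring: E.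
Qed.

(** [lap_node] with the flow from [v] back to [p] eliminated: by [V_edge],
    [(a v - flow a v p) / V v v] is [flow a p v / V p v]. *)
Lemma lap_node_child a p v : adj p v ->
  lap a v = flow a p v / V p v - \sum_(i | adj v i && (i != p)) flow a v i / V v v.
Proof.
move=> pv; have vp : adj v p by rewrite adjC.
have E := lap_node a v; rewrite (bigD1 p) //= in E.
have E2 : V p v * V p v = V p p * V v v - V p v by rewrite -V_edge //; ring.
have -> : lap a v = (a v - flow a v p
    - \sum_(i | adj v i && (i != p)) flow a v i) / V v v.
  by rewrite -[in X in X - _ - _]E; field.
rewrite -mulr_suml mulrBl; congr (_ - _).
apply: (mulIf (V_neq0 v v)); apply: (mulIf (V_neq0 p v)).
rewrite divfK // mulrAC divfK //.
by rewrite /flow (VC v p); ring: E2.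
Qed.

Lemma lap_int a j : (forall i, a i \is a Num.int) -> lap a j \is a Num.int.
Proof. by move=> a_int; rewrite rpredB ?rpredM ?rpred_sum. Qed.

(** The quotient is the entry [V i j], here by [V_across] and in the next lemma by [V_along]. *)
Lemma V_across_int v i i' j : adj v i -> adj v i' -> i != i' ->
  j \in branch_of v i' -> V v i * V v j / V v v \is a Num.int.
Proof.
move=> vi vi' ii' jB; rewrite mulrC (mulrC (V v i)) -(V_across vi' jB) ?mulKf //.
apply: contra ii' => iB; apply/eqP.
by apply: (branch_inj vi vi' _ iB); rewrite branch_root // eq_sym adj_neq.
Qed.

Lemma V_along_int v i j : adj v i -> j \in branch_of v i ->
  (V v i + 1) * V v j / V v v \is a Num.int.
Proof. by move=> vi jB; rewrite V_along // mulrC mulKf. Qed.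

(** With the next lemma: the denominator of [flow a v i / V v v] divides [V v i + 1], and that of
    the flow through any other neighbour divides [V v i]. Hence these denominators are coprime. *)
Lemma flow_across_int a v i i' : (forall j, a j \is a Num.int) ->
  adj v i -> adj v i' -> i != i' -> V v i * flow a v i' / V v v \is a Num.int.
Proof.
move=> a_int vi vi' ii'; rewrite flowE // mulr_sumr mulr_suml rpred_sum // => j jB.
by rewrite mulrCA -mulrA rpredM ?lap_int // (V_across_int vi vi').
Qed.

Lemma flow_along_int a v i : (forall j, a j \is a Num.int) ->
  adj v i -> (V v i + 1) * flow a v i / V v v \is a Num.int.
Proof.
move=> a_int vi; rewrite flowE // mulr_sumr mulr_suml rpred_sum // => j jB.
by rewrite mulrCA -mulrA rpredM ?lap_int // V_along_int.
Qed.

Definition degree v := #|[set j | adj v j]|.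

Lemma degreeE v : (degree v)%:R = \sum_(i | adj v i) 1 :> rat.
Proof. by rewrite /degree cardsE sumr_const. Qed.

Lemma degree_child p v : adj p v ->
  (degree v)%:R = 1 + \sum_(i | adj v i && (i != p)) 1 :> rat.
Proof. by move=> pv; rewrite degreeE (bigD1 p) // adjC. Qed.

(** * The gcds of rows of V over branches *)

Definition sgen_of (p v : T) : nat :=
  \big[gcdn/0%N]_(i in branch_of p v :|: [set p]) absz (numq (V p i)).

Lemma absz_V p i : (absz (numq (V p i)))%:R = V p i.
Proof.
rewrite natr_absz gtr0_norm ?numq_gt0 //.
by have /intrP[z ->] := V_int p i; rewrite numq_int.
Qed.

Lemma V_sgen_int p v i : i \in p |: branch_of p v ->
  V p i / (sgen_of p v)%:R \is a Num.int.
Proof.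
rewrite setUC => iB; rewrite -absz_V.
have /dvdnP[k ->] : (sgen_of p v %| absz (numq (V p i)))%N.
  by rewrite /sgen_of (bigD1 i iB) dvdn_gcdl.
case: (eqVneq (sgen_of p v) 0%N) => [->|s0]; first by rewrite muln0 mul0r.
by rewrite natrM mulfK ?pnatr_eq0.
Qed.

Lemma sgen_gt0 p v : (0 < sgen_of p v)%N.
Proof.
rewrite /sgen_of (bigD1 p) /= ?inE ?eqxx ?orbT // gcdn_gt0 absz_gt0.
by rewrite numq_eq0 V_neq0.
Qed.

Lemma sgen_self p : (sgen_of p p)%:R = V p p.
Proof.
by rewrite /sgen_of /branch_of eqxx set0U big_set1 absz_V.
Qed.

Lemma sgen_branch p v i : i \in branch_of p v -> sgen_of p i = sgen_of p v.
Proof. by move=> iB; rewrite /sgen_of (branch_eq iB). Qed.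

(** Bezout: the gcd is an integral combination of the [V p i]. With [e = V p p] this yields the two
    divisibilities by [V p p] stated in the overview. *)
Lemma sgen_mul_int c e p v :
  (forall i, i \in p |: branch_of p v -> c * V p i / e \is a Num.int) ->
  c * (sgen_of p v)%:R / e \is a Num.int.
Proof.
move=> V_e; rewrite /sgen_of.
apply: (big_ind (fun n : nat => c * n%:R / e \is a Num.int)).
- by rewrite mulr0 mul0r rpred0.
- move=> m n m_e n_e; have [->|m_gt0] := posnP m; first by rewrite gcd0n.
  case: (egcdnP n m_gt0) => km kn E _.
  have -> : c * (gcdn m n)%:R / e = km%:R * (c * m%:R / e) - kn%:R * (c * n%:R / e).
    have : (kn * n + gcdn m n)%:R = (km * m)%:R :> rat by rewrite E.
    by rewrite natrD !natrM addrC => /(canRL (addrK _)) ->; ring.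
  by apply: rpredB; apply: rpredM; rewrite ?rpred_nat.
- by move=> i iB; rewrite absz_V V_e // setUC.
Qed.

(** * Integral vectors above xi d *)

Variables (dh : T -> nat) (xi : rat).
Hypothesis xi_gt0 : 0 < xi.

Definition dvec (j : T) : rat := \sum_i (dh i)%:R * V i j.

Lemma lap_dvec j : lap dvec j = (dh j)%:R.
Proof.
rewrite lap_sum (bigD1 j) //= lapV eqxx big1 ?addr0 ?mulr1 // => i ij.
by rewrite lapV eq_sym (negPf ij) mulr0.
Qed.

Lemma flow_dvec p v : adj p v ->
  flow dvec p v = \sum_(j in branch_of p v) (dh j)%:R * V p j.
Proof. by move=> pv; rewrite flowE //; apply: eq_bigr => j _; rewrite lap_dvec. Qed.

Lemma flow_dvec_ge0 p v : adj p v -> 0 <= flow dvec p v.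
Proof.
move=> pv; rewrite flow_dvec //; apply: sumr_ge0 => j _.
by rewrite mulr_ge0 ?ler0n ?ltW.
Qed.

Lemma flow_dvec_eq0 p v : adj p v -> flow dvec p v = 0 ->
  forall j, j \in branch_of p v -> dh j = 0%N.
Proof.
move=> pv /eqP; rewrite flow_dvec // psumr_eq0 => [/allP D0 j jB|j _].
  have := D0 j (mem_index_enum _).
  by rewrite jB /= mulf_eq0 (negPf (V_neq0 _ _)) orbF pnatr_eq0 => /eqP.
by rewrite mulr_ge0 ?ler0n ?ltW.
Qed.

(** The conditions on [a = f + k + 1] at [j]: integrality, the quotient of [a j] by d at [j] being
    at least [xi], and, through adjunction, antinefness of F. *)
Definition above (a : T -> rat) (j : T) : Prop :=
  [/\ a j \is a Num.int, xi * dvec j <= a j & 2 - (degree j)%:R <= lap a j].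

(* On such a branch the excess a - xi d would vanish at a vertex v and be       *)
(* positive at its children; it is integral there because the flows through    *)
(* the children have pairwise coprime denominators. Thus lap a v would be at    *)
(* most 1 - degree v.                                                           *)
Lemma above_not_tight n p v a : (#|branch_of p v| < n)%N -> adj p v ->
  (forall j, above a j) -> (forall j, j \in branch_of p v -> dh j = 0%N) ->
  a p = xi * dvec p -> a v = xi * dvec v -> False.
Proof.
elim: n p v => [//|n IHn] p v; rewrite ltnS => Bn pv aA dh0 ap av.
have a_int j : a j \is a Num.int by case: (aA j).
have vp : adj v p by rewrite adjC.
pose y j := 1 * a j + (- xi) * dvec j.
have yp : y p = 0 by rewrite /y ap; ring.
have yv : y v = 0 by rewrite /y av; ring.
have vB : v \in branch_of p v by rewrite branch_root // eq_sym adj_neq.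
have lap_y : lap a v = - \sum_(i | adj v i) y i.
  have : lap y v = lap a v by rewrite lap_linear lap_dvec dh0 // mulr0 addr0 mul1r.
  by move=> <-; rewrite /lap yv mulr0 sub0r.
have y_flow i : adj v i -> i != p -> y i = flow a v i / V v v.
  move=> vi ip.
  have d0 : flow dvec v i = 0.
    rewrite flow_dvec // big1 // => j jB; rewrite dh0 ?mul0r //.
    by apply: (subsetP (branch_sub pv vi ip)).
  have : flow y v i = flow a v i by rewrite flow_linear d0; ring.
  by rewrite {1}/flow yv => <-; rewrite mulr0 subr0 mulrC mulKf.
have y_int i : adj v i -> i != p -> y i \is a Num.int.
  move=> vi ip.
  (* [y i] is the difference of its multiples by [V v i + 1] and [V v i]. The first is integral by
     [flow_along_int]. For the second, [V v i] clears the denominators of the other [y l], and all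
     the [y l] sum to the integer [- lap a v]. *)
  have -> : y i = (V v i + 1) * flow a v i / V v v - V v i * y i.
    by rewrite (y_flow i) //; ring.
  rewrite rpredB ?flow_along_int //.
  have -> : V v i * y i = - (V v i * lap a v) - \sum_(l | adj v l && (l != i)) V v i * y l.
    by rewrite lap_y (bigD1 i) //= -mulr_sumr; ring.
  rewrite rpredB ?rpredN ?rpredM ?lap_int ?rpred_sum // => l /andP[vl li].
  case: (eqVneq l p) => [->|lp]; first by rewrite yp mulr0 rpred0.
  by rewrite y_flow // mulrA flow_across_int // eq_sym.
have y_ge1 i : adj v i -> i != p -> 1 <= y i.
  move=> vi ip; have y_ge0 : 0 <= y i by rewrite /y; case: (aA i) => _; lra.
  rewrite -[1]add0r -rat_int_lt ?y_int // lt_neqAle y_ge0 andbT eq_sym.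
  apply/eqP => yi; apply: (IHn v i) => //.
  - by apply: leq_trans Bn; apply: branch_card_lt.
  - by move=> j jB; apply: dh0; apply: (subsetP (branch_sub pv vi ip)).
  - by move: yi; rewrite /y; lra.
have [_ _] := aA v; rewrite lap_y (bigD1 p vp) /= -/(y p) yp (degree_child pv).
have : \sum_(i | adj v i && (i != p)) 1 <= \sum_(i | adj v i && (i != p)) y i.
  by apply: ler_sum => i /andP[]; apply: y_ge1.
by lra.
Qed.

(** The flow is [xi * flow dvec p v] plus [V p p] times the excess at [v], both nonnegative. If both
    vanish, then [dh] is zero on the branch and [v] is tight, which [above_not_tight] excludes. *)
Lemma above_flow a p v : (forall j, above a j) -> a p = xi * dvec p -> adj p v ->
  0 < flow a p v /\ xi * flow dvec p v <= flow a p v.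
Proof.
move=> aA ap pv.
have E : flow a p v = xi * flow dvec p v + V p p * (a v - xi * dvec v).
  by rewrite /flow ap; ring.
have y_ge0 : 0 <= a v - xi * dvec v by rewrite subr_ge0; case: (aA v).
have fd_ge0 := mulr_ge0 (ltW xi_gt0) (flow_dvec_ge0 pv).
have Vy_ge0 := mulr_ge0 (ltW (V_gt0 p p)) y_ge0.
split; last by rewrite E lerDl.
rewrite lt_neqAle E addr_ge0 // andbT eq_sym paddr_eq0 // !mulf_eq0.
rewrite (gt_eqF xi_gt0) (negPf (V_neq0 p p)) /=.
apply/andP => -[/eqP/(flow_dvec_eq0 pv) dh0 /eqP/subr0_eq av].
exact: (above_not_tight (ltnSn _) pv aA dh0 ap av).
Qed.

Lemma eq_above a b j : a j = b j -> lap a j = lap b j -> above b j -> above a j.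
Proof. by rewrite /above => -> ->. Qed.

(** Branches picked out by [Q] are filled by the given vectors; other neighbours only receive their
    value [x i]. [Q] omits the parent when extending away from it, and is everything at the root. *)
Lemma glue_above v (av : rat) (x : T -> rat) (Q : pred T) :
  (forall i, adj v i -> Q i -> exists f : T -> rat,
     [/\ f v = av, f i = x i & forall j, j \in branch_of v i -> above f j]) ->
  exists a : T -> rat, [/\ a v = av, (forall i, adj v i -> a i = x i) &
    forall i j, adj v i -> Q i -> j \in branch_of v i -> above a j].
Proof.
move=> Hf.
have /fin_all_exists[f fP] i : exists f : T -> rat, adj v i ->
    [/\ f v = av, f i = x i & Q i -> forall j, j \in branch_of v i -> above f j].
  have [/andP[vi Qi]|NQ] := boolP (adj v i && Q i).
    by have [f [? ? ?]] := Hf i vi Qi; exists f.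
  exists (fun j => if j == v then av else x i) => vi.
  rewrite eqxx (negPf (adj_neq _)) 1?adjC //; split=> // Qi.
  by rewrite vi Qi in NQ.
have [a [a_v aE]] := @branch_glue _ v av f (fun i vi => let: And3 H _ _ := fP i vi in H).
have iB i : adj v i -> i \in branch_of v i.
  by move=> vi; rewrite branch_root // eq_sym adj_neq.
exists a; split=> // [i vi|i j vi Qi jB].
  by have [_ <- _] := fP i vi; rewrite (aE i) // in_setU1 iB // orbT.
have [_ _ /(_ Qi j jB)] := fP i vi; apply: eq_above.
  by rewrite (aE i) // in_setU1 jB orbT.
by apply: (eq_lap_branch vi jB) => l; apply: aE.
Qed.

(** The least integer exceeding [al] and at least [al + be]: [floor al + 1] if [be] is 0, which may
    equal [al + 1], and otherwise the ceiling, which stays strictly below [al + be + 1]. The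
    strictness settles the equality case in [extend_branch]. *)
Lemma child_value (al be : rat) : 0 <= be -> exists x : rat,
  [/\ x \is a Num.int, al < x, al + be <= x, x <= al + be + 1 &
      0 < be -> x < al + be + 1].
Proof.
rewrite le_eqVlt => /predU1P[<-|be_gt0].
  exists (Num.floor al + 1)%:~R; have /andP[] := floor_itv al.
  by rewrite intrD rpredD ?intr_int //; split=> //; lra.
exists (Num.ceil (al + be))%:~R; have /andP[] := ceil_itv (al + be).
by rewrite intrD intr_int; split=> //; lra.
Qed.

(* Give each child the least value admissible for its own branch; summing the   *)
(* resulting flows through v, integrality of lap leaves just enough room at v.  *)
Lemma extend_branch n p v (ap av : rat) : (#|branch_of p v| < n)%N -> adj p v ->
  ap \is a Num.int -> av \is a Num.int -> xi * dvec p <= ap ->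
  0 < V p p * av - V p v * ap ->
  xi * flow dvec p v <= V p p * av - V p v * ap ->
  exists a : T -> rat,
    [/\ a p = ap, a v = av & forall j, j \in branch_of p v -> above a j].
Proof.
elim: n p v ap av => [//|n IHn] p v ap av; rewrite ltnS => Bn pv.
move=> ap_int av_int ap_ge F_gt0 F_ge; have vp : adj v p by rewrite adjC.
have av_ge : xi * dvec v <= av.
  rewrite -(ler_pM2l (V_gt0 p p)).
  have := mulr_ge0 (ltW (V_gt0 p v)) (etrans (subr_ge0 _ _) ap_ge).
  by move: F_ge; rewrite /flow; lra.
(* Given [av] at [v], [flow a v i / V v v] is [a i - al i]: so [al i] is the value of zero flow, and
   [be i] the excess that carries [xi] times the flow of d. *)
pose al i := V v i * av / V v v; pose be i := xi * flow dvec v i / V v v.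
have be_ge0 i : adj v i -> 0 <= be i.
  by move=> vi; rewrite divr_ge0 ?mulr_ge0 ?flow_dvec_ge0 // ltW.
(* The parent [p] is also a neighbour of [v]; its value is already fixed. *)
have /fin_all_exists[x xP] i : exists x : rat, if i == p then x = ap else
    adj v i -> [/\ x \is a Num.int, al i < x, al i + be i <= x,
                   x <= al i + be i + 1 & 0 < be i -> x < al i + be i + 1].
  case: eqP => _; first by exists ap.
  have [vi|_] := boolP (adj v i); last by exists 0.
  by have [x xP] := child_value (al i) (be_ge0 i vi); exists x.
have xp : x p = ap by have := xP p; rewrite eqxx.
have {}xP i : adj v i -> i != p -> [/\ x i \is a Num.int, al i < x i,
    al i + be i <= x i, x i <= al i + be i + 1 & 0 < be i -> x i < al i + be i + 1].
  by move=> vi /negPf ip; have := xP i; rewrite ip; apply.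
have [|a [a_v ax aA]] := @glue_above v av x (predC1 p).
  move=> i vi /= ip; have [x_int x1 x2 _ _] := xP i vi ip; apply: IHn => //.
  - by apply: leq_trans Bn; apply: branch_card_lt.
  - by move: x1; rewrite /al ltr_pdivrMr //; lra.
  - by move: x2; rewrite /al /be -mulrDl ler_pdivrMr //; lra.
exists a; split=> // [|j jB]; first by rewrite ax.
have [->|jv] := eqVneq j v; last first.
  have [i vi jBi] := branch_cover jv; apply: (aA i) => //=.
  by apply: contraTneq jB => ip; rewrite -(branch_compl _ pv) -ip.
have phiE i : flow a v i / V v v = a i - al i.
  by rewrite /flow a_v /al; field.
have FE : flow a p v = V p p * av - V p v * ap by rewrite /flow a_v ax // xp.
have lap_a := lap_node_child a pv; have := lap_node_child dvec pv.
rewrite lap_dvec => lap_d.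
(* The bound on the flow into [v] passes to the children because [lap dvec v] is [dh v], which is
   nonnegative. *)
have R_ge : \sum_(i | adj v i && (i != p)) be i <= flow a p v / V p v.
  apply: le_trans (_ : xi * flow dvec p v / V p v <= _); last first.
    by rewrite ler_pM2r ?invr_gt0 // FE.
  rewrite -mulrA; rewrite -[flow dvec p v / _](subrK
    (\sum_(i | adj v i && (i != p)) flow dvec v i / V v v)) -lap_d.
  rewrite mulrDr mulr_sumr ler_wpDl ?(mulr_ge0 (ltW xi_gt0)) ?ler0n //.
  by rewrite [X in _ <= X](eq_bigr be) // => i _; rewrite /be mulrA.
have R_gt0 : 0 < flow a p v / V p v by rewrite divr_gt0 // FE.
split; rewrite ?a_v //.
have lap_a_int : lap a v \is a Num.int.
  rewrite rpredB ?rpredM // ?a_v //; apply: rpred_sum => i vi; rewrite ax //.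
  by have [->|ip] := eqVneq i p; [rewrite xp | case: (xP i vi ip)].
have -> : 2 - (degree v)%:R = 1 - (degree v)%:R + 1 :> rat by ring.
have deg_int : 1 - (degree v)%:R \is a @Num.int rat.
  by apply: rpredB; rewrite ?rpred1 ?rpred_nat.
rewrite -(rat_int_lt deg_int lap_a_int) (degree_child pv).
(* Otherwise the flows to the children, over [V v v], sum to at least their number plus
   [flow a p v / V p v], hence plus the sum of the [be i]. Each is at most [1 + be i], so all are
   equalities; strictness then forces every [be i] to be 0, and the flow into [v] would not be
   positive. *)
rewrite lap_a ltNge; apply/negP => bad.
have gap_ge0 i : adj v i && (i != p) -> 0 <= 1 + be i - flow a v i / V v v.
  by case/andP=> vi ip; rewrite phiE ax //; have [_ _ _] := xP i vi ip; lra.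
have gap_sum : \sum_(i | adj v i && (i != p)) (1 + be i - flow a v i / V v v) =
    \sum_(i | adj v i && (i != p)) 1 + \sum_(i | adj v i && (i != p)) be i
     - \sum_(i | adj v i && (i != p)) flow a v i / V v v.
  by rewrite sumrB big_split.
have gap0 : \sum_(i | adj v i && (i != p)) (1 + be i - flow a v i / V v v) = 0.
  by apply/eqP; rewrite eq_le sumr_ge0 // andbT gap_sum; lra.
have be0 : \sum_(i | adj v i && (i != p)) be i = 0.
  apply: big1 => i iP; have gi := psumr_eq0P gap_ge0 gap0 iP.
  case/andP: iP => vi ip; apply/eqP; rewrite eq_le be_ge0 // andbT leNgt.
  have [_ _ _ _ strict] := xP i vi ip; apply/negP => /strict.
  by move: gi; rewrite phiE ax //; lra.
by move: gap0; rewrite gap_sum be0; lra.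
Qed.

(** * The numerical criterion at a vertex *)

Lemma ceilp_le x z : z \is a Num.int -> ((ceilp x)%:~R <= z) = (1 <= z) && (x <= z).
Proof. by move=> /intrP[m ->]; rewrite ler_int ge_max ceil_le_int ler1z. Qed.

Lemma ceilp_ge1 x : 1 <= (ceilp x)%:~R :> rat.
Proof. by have := ceilp_le x (intr_int _ (ceilp x)); rewrite lexx => /esym/andP[]. Qed.

(** Measured in units of [sgen_of p v], of which the flow of an integral vector is a multiple. *)
Definition least_flow (p v : T) : int :=
  ceilp ((\sum_(i in branch_of p v) (dh i)%:R * V p i) / (sgen_of p v)%:R * xi).

Definition hval (p : T) : rat :=
  dvec p * xi + ((degree p)%:R - 2) * V p p
  - \sum_(v | adj p v) (sgen_of p v)%:R * (least_flow p v)%:~R.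

Lemma least_flowP p v z : adj p v -> z \is a Num.int ->
  ((least_flow p v)%:~R <= z) =
  (1 <= z) && (xi * flow dvec p v <= (sgen_of p v)%:R * z).
Proof.
move=> pv z_int; rewrite /least_flow -flow_dvec // ceilp_le //; congr (_ && _).
by rewrite mulrC mulrA ler_pdivrMr ?ltr0n ?sgen_gt0 // [z * _]mulrC.
Qed.

(** The coefficients are slacks: at [p] that of the bound on [lap a p], with generator [V p p], and
    at a neighbour the excess of the flow over [least_flow]. By [lap_node] they add up to
    [hval p]. *)
Lemma hval_of_above p a : (forall j, above a j) -> a p = xi * dvec p ->
  exists c : T -> nat, hval p = (\sum_v c v * sgen_of p v)%N%:R.
Proof.
move=> aA ap; have a_int j : a j \is a Num.int by case: (aA j).
have /fin_all_exists[c cP] v : exists n : nat, n%:R =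
    if v == p then lap a p + (degree p)%:R - 2
    else if adj p v then flow a p v / (sgen_of p v)%:R - (least_flow p v)%:~R
    else 0.
  suff /natrP[n ->] : (if v == p then lap a p + (degree p)%:R - 2
    else if adj p v then flow a p v / (sgen_of p v)%:R - (least_flow p v)%:~R
    else 0) \is a Num.nat by exists n.
  rewrite natrEint; case: (eqVneq v p) => _.
    rewrite -addrA rpredD ?lap_int ?rpredB ?rpred_nat //=.
    by have [_ _] := aA p; lra.
  case: ifP => pv; last by rewrite rpred0 lexx.
  have [f_gt0 f_ge] := above_flow aA ap pv.
  have s_gt0 : 0 < (sgen_of p v)%:R :> rat by rewrite ltr0n sgen_gt0.
  have f_int : flow a p v / (sgen_of p v)%:R \is a Num.int.
    rewrite flowE // mulr_suml rpred_sum // => j jB.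
    by rewrite -mulrA rpredM ?lap_int // V_sgen_int // in_setU1 jB orbT.
  rewrite rpredB ?intr_int //= subr_ge0 least_flowP //.
  rewrite [_ * (_ / _)]mulrC divfK ?gt_eqF // f_ge andbT.
  by rewrite -[1]add0r -rat_int_lt ?rpred0 // divr_gt0.
exists c; rewrite natr_sum (bigD1 p) //= natrM sgen_self cP eqxx.
rewrite (bigID (adj p)) /= [X in _ + (_ + X)]big1 ?addr0 => [|v /andP[/negPf vp /negPf pv]].
  have -> : \sum_(i | (i != p) && adj p i) (c i * sgen_of p i)%:R =
      \sum_(i | adj p i) (flow a p i - (sgen_of p i)%:R * (least_flow p i)%:~R) :> rat.
    apply: eq_big => [i|i /andP[/negPf ip pi]].
      by case: (boolP (adj p i)) => [/adj_neq|_]; rewrite ?andbF // eq_sym andbT.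
    rewrite natrM cP ip pi mulrBl divfK ?pnatr_eq0 -?lt0n ?sgen_gt0 //.
    by rewrite [X in _ - X]mulrC.
  rewrite sumrB /hval.
  have -> : \sum_(i | adj p i) flow a p i = dvec p * xi - V p p * lap a p.
    by rewrite -(mulrC xi) -ap -[X in X - _](lap_node a p); ring.
  by ring.
by rewrite natrM cP vp pv mul0r.
Qed.

Lemma above_of_hval p (c : T -> nat) : hval p = (\sum_v c v * sgen_of p v)%N%:R ->
  exists a, (forall j, above a j) /\ a p = xi * dvec p.
Proof.
set t := xi * dvec p.
(* The flow prescribed through [v]: the least admissible one plus the contribution of all vertices
   of the branch, whose generators coincide by [sgen_branch]. *)
pose m v : rat := (sgen_of p v)%:R *
  ((least_flow p v)%:~R + \sum_(i in branch_of p v) (c i)%:R).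
rewrite natr_sum (sum_branch _ p) natrM sgen_self => hE.
have {hE} tE : t = ((c p)%:R + 2 - (degree p)%:R) * V p p + \sum_(v | adj p v) m v.
  have -> : \sum_(v | adj p v) m v =
    \sum_(v | adj p v) (sgen_of p v)%:R * (least_flow p v)%:~R +
    \sum_(v | adj p v) \sum_(i in branch_of p v) (c i * sgen_of p i)%:R.
    rewrite -big_split; apply: eq_bigr => v pv /=.
    rewrite /m mulrDr mulr_sumr; congr (_ + _); apply: eq_bigr => i iB.
    by rewrite natrM (sgen_branch iB) mulrC.
  by move: hE; rewrite /hval /t; lra.
have s_gt0 v : 0 < (sgen_of p v)%:R :> rat by rewrite ltr0n sgen_gt0.
have n_int v : (least_flow p v)%:~R + \sum_(i in branch_of p v) (c i)%:R \is a @Num.int rat.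
  by rewrite rpredD ?intr_int ?rpred_sum // => i _; rewrite rpred_nat.
have m_int v : m v \is a Num.int by rewrite rpredM ?rpred_nat.
have k_int : (c p)%:R + 2 - (degree p)%:R \is a @Num.int rat.
  by rewrite rpredB ?rpredD ?rpred_nat.
have t_int : t \is a Num.int by rewrite tE rpredD ?rpredM ?rpred_sum.
pose x v := (V p v * t + m v) / V p p.
have along v : adj p v -> (V p v + 1) * m v / V p p \is a Num.int.
  move=> pv; rewrite /m mulrA mulrAC rpredM // sgen_mul_int // => i.
  rewrite in_setU1 => /predU1P[->|iB]; last exact: V_along_int.
  by rewrite mulfK ?rpredD ?rpred1.
have across u v : adj p u -> adj p v -> u != v -> V p u * m v / V p p \is a Num.int.
  move=> pu pv uv; rewrite /m mulrA mulrAC rpredM // sgen_mul_int // => i.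
  rewrite in_setU1 => /predU1P[->|iB]; last exact: V_across_int iB.
  by rewrite mulfK.
have x_int v : adj p v -> x v \is a Num.int.
  move=> pv.
  (* Expanding [t] by [tE], the summand of [v] joins [m v] and gives the factor [V p v + 1]; those
     of the other neighbours keep the factor [V p v]. *)
  have -> : x v = V p v * ((c p)%:R + 2 - (degree p)%:R)
      + \sum_(u | adj p u && (u != v)) V p v * m u / V p p
      + (V p v + 1) * m v / V p p.
    by rewrite /x tE (bigD1 v) //= -mulr_suml -mulr_sumr; field.
  apply: rpredD; last exact: along.
  rewrite rpredD ?rpredM // rpred_sum // => u /andP[pu uv].
  by rewrite across // eq_sym.
have flowx v : V p p * x v - V p v * t = m v by rewrite /x; field.
have [|a [a_p ax aA]] := @glue_above p t x predT.
  move=> v pv _; apply: (extend_branch (ltnSn _) pv t_int (x_int v pv)); rewrite ?lexx // flowx.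
    rewrite mulr_gt0 // ltr_wpDr ?sumr_ge0 //.
    exact: lt_le_trans ltr01 (ceilp_ge1 _).
  have : (least_flow p v)%:~R <= (least_flow p v)%:~R
     + \sum_(i in branch_of p v) (c i)%:R :> rat.
    by rewrite lerDl sumr_ge0.
  by rewrite (least_flowP pv (n_int v)) => /andP[].
exists a; split=> // j; have [->|jp] := eqVneq j p; last first.
  by have [v pv jB] := branch_cover jp; apply: (aA v).
split; rewrite ?a_p // -subr_ge0.
(* Once the flows are prescribed, [lap_node] determines [lap a p]; [tE] gives its value. *)
have lap_a : V p p * (lap a p - ((c p)%:R + 2 - (degree p)%:R)) = 0.
  have := lap_node a p; rewrite a_p (eq_bigr m); last first.
    by move=> v pv; rewrite /flow a_p ax.
  by rewrite tE; lra.
move/eqP: lap_a; rewrite mulf_eq0 (negPf (V_neq0 p p)) subr_eq0 => /eqP->.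
by have : 0 <= (c p)%:R :> rat; [exact: ler0n | lra].
Qed.

End Tree.

(** * The dual graph of a sequence of blowups *)

(* Acyclicity is expressed by a cut across each edge, a form that is easily     *)
(* preserved when an edge is subdivided.                                        *)
Record nat_tree (k : nat) (g : rel nat) : Prop := NatTree {
  nat_tree_sym : symmetric g;
  nat_tree_dom : forall x y, g x y -> [/\ (x <= k)%N, (y <= k)%N & x != y];
  nat_tree_conn : forall C : pred nat, (forall x y, g x y -> C x -> C y) ->
    forall x y, (x <= k)%N -> (y <= k)%N -> C x -> C y;
  nat_tree_cut : forall x y, g x y -> exists C : pred nat,
    [/\ C x, ~~ C y & forall u v, g u v -> C u -> ~~ C v -> u = x /\ v = y] }.

Lemma nat_tree0 : nat_tree 0 (fun _ _ => false).
Proof. by split=> // C _ x y; rewrite !leqn0 => /eqP-> /eqP->. Qed.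

Definition extend_pred (m : nat) (b : bool) (C : pred nat) : pred nat :=
  fun z => if z == m then b else C z.

Lemma extend_pred_new m b C : extend_pred m b C m = b.
Proof. by rewrite /extend_pred eqxx. Qed.

Lemma extend_pred_old k b C z : (z <= k)%N -> extend_pred k.+1 b C z = C z.
Proof. by rewrite /extend_pred => zk; rewrite ltn_eqF. Qed.

(** The new vertex is a leaf. Old cuts extend by placing it on the side of [a]; the new edge is cut
    by the new vertex alone or by its complement. *)
Lemma nat_tree_free k g a : nat_tree k g -> (a < k.+1)%N ->
  nat_tree k.+1 (upd k.+1 g (Free a)).
Proof.
move=> [gC gdom gconn gcut]; rewrite ltnS => ak; have am : a != k.+1 by rewrite ltn_eqF.
split=> /= [x y|x y|C Cstep|x y].
- by rewrite gC; congr orb; rewrite orbC; congr orb; apply: andbC.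
- case/or3P=> [/gdom[xk yk xy]|/andP[/eqP-> /eqP->]|/andP[/eqP-> /eqP->]].
  + by rewrite !leqW.
  + by rewrite leqnn leqW // eq_sym.
  + by rewrite leqnn leqW.
- have old : forall x y, (x <= k)%N -> (y <= k)%N -> C x -> C y.
    by apply: gconn => x y xy; apply: Cstep; rewrite xy.
  have Ca x : (x <= k.+1)%N -> C x -> C a.
    rewrite leq_eqVlt => /predU1P[->|xk]; last exact: old.
    by apply: Cstep; rewrite !eqxx orbT.
  move=> x y xk yk /(Ca x xk) {xk}; move: yk.
  rewrite leq_eqVlt => /predU1P[->|yk]; last exact: old.
  by apply: Cstep; rewrite !eqxx !orbT.
- case/or3P=> [xy|/andP[/eqP-> /eqP->]|/andP[/eqP-> /eqP->]].
  + have [xk yk _] := gdom _ _ xy; have [C [Cx Cy exitC]] := gcut _ _ xy.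
    exists (extend_pred k.+1 (C a) C); rewrite !extend_pred_old //; split=> // u v.
    case/or3P=> [uv|/andP[/eqP-> /eqP->]|/andP[/eqP-> /eqP->]].
    * by have [uk vk _] := gdom _ _ uv; rewrite !extend_pred_old //; apply: exitC.
    * by rewrite extend_pred_new extend_pred_old // => ->.
    * by rewrite extend_pred_new extend_pred_old // => ->.
  + exists (pred1 k.+1); rewrite /= eqxx am; split=> // u v uv /eqP uE vm.
    move: uv; rewrite uE; case/or3P=> [/gdom[]|/andP[_ /eqP->] //|/andP[_ vE]]; first by rewrite ltnn.
    by rewrite /= vE in vm.
  + exists (predC1 k.+1); rewrite /= eqxx am; split=> // u v uv um /negPn/eqP vE.
    move: uv; rewrite vE; case/or3P=> [/gdom[_]|/andP[uE _]|/andP[/eqP-> _] //]; first by rewrite ltnn.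
    by rewrite /= uE in um.
Qed.

(** The edge [a c] is subdivided. Its old cut serves both halves, according to the side given to the
    new vertex. Every other old cut has [a] and [c] on one side, where the new vertex is placed
    too. *)
Lemma nat_tree_sat k g a c : nat_tree k g ->
  (a < k.+1)%N -> (c < k.+1)%N -> a != c -> g a c ->
  nat_tree k.+1 (upd k.+1 g (Sat a c)).
Proof.
move=> [gC gdom gconn gcut]; rewrite !ltnS => ak ck ac gac.
have am : a != k.+1 by rewrite ltn_eqF.
have cm : c != k.+1 by rewrite ltn_eqF.
have gca : g c a by rewrite gC.
split=> /= [x y|x y|C Cstep|x y].
- rewrite (gC y x) [(y == a) && _]andbC [(y == c) && _]andbC.
  rewrite [(x == c) && (y == a) || _]orbC.
  by congr orb; rewrite orbC; congr orb; apply: andbC.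
- case/or3P=> [/andP[/gdom[xk yk xy] _]|/andP[/eqP->]|/andP[+ /eqP->]].
  + by rewrite !leqW.
  + by case/orP=> /eqP->; rewrite leqnn leqW // eq_sym.
  + by case/orP=> /eqP->; rewrite leqnn leqW.
- have stepm x : (x == a) || (x == c) -> C x -> C k.+1.
    by move=> xac; apply: Cstep; rewrite xac eqxx !orbT.
  have mstep x : (x == a) || (x == c) -> C k.+1 -> C x.
    by move=> xac; apply: Cstep; rewrite xac eqxx !orbT.
  have old : forall x y, (x <= k)%N -> (y <= k)%N -> C x -> C y.
    apply: gconn => x y xy; have [xyac|nxyac] :=
        boolP ((x == a) && (y == c) || (x == c) && (y == a)).
      move=> Cx; apply: mstep; last apply: (stepm x) => //.
        by case/orP: xyac => /andP[_ ->]; rewrite ?orbT.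
      by case/orP: xyac => /andP[-> _]; rewrite ?orbT.
    by apply: Cstep; rewrite xy nxyac.
  have Ca x : (x <= k.+1)%N -> C x -> C a.
    rewrite leq_eqVlt => /predU1P[->|xk]; last exact: old.
    by apply: mstep; rewrite eqxx.
  move=> x y xk yk /(Ca x xk) {xk}; move: yk.
  rewrite leq_eqVlt => /predU1P[->|yk]; last exact: old.
  by apply: stepm; rewrite eqxx.
- have cut_new p q : (p == a) && (q == c) || (p == c) && (q == a) -> forall b,
    exists C : pred nat, [/\ C p, ~~ C q, C k.+1 = b &
      forall u v, upd k.+1 g (Sat a c) u v -> C u -> ~~ C v ->
        if b then u = k.+1 /\ v = q else u = p /\ v = k.+1].
    move=> pq b.
    have [gpq pk qk] : [/\ g p q, (p <= k)%N & (q <= k)%N].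
      by case/orP: pq => /andP[/eqP-> /eqP->].
    have acE z : (z == a) || (z == c) -> z = p \/ z = q.
      by case/orP: pq => /andP[/eqP-> /eqP->] /orP[] /eqP->; auto.
    have [C [Cp Cq exitC]] := gcut _ _ gpq.
    exists (extend_pred k.+1 b C).
    rewrite (extend_pred_old b C pk) (extend_pred_old b C qk) extend_pred_new.
    split=> // u v /=.
    case/or3P=> [/andP[uv nac]|/andP[/eqP->]|/andP[+ /eqP->]].
    * have [uk vk _] := gdom _ _ uv; rewrite !extend_pred_old // => Cu Cv.
      by have [uE vE] := exitC _ _ uv Cu Cv; rewrite uE vE pq in nac.
    * rewrite extend_pred_new => /acE vE bT.
      rewrite bT; case: vE => -> //; first by rewrite extend_pred_old // Cp.
    * rewrite extend_pred_new => /acE uE + /negPf ->.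
      by case: uE => -> //; rewrite extend_pred_old // (negPf Cq).
  case/or3P=> [/andP[xy nac]|/andP[/eqP->]|/andP[+ /eqP->]].
  + have [xk yk _] := gdom _ _ xy; have [C [Cx Cy exitC]] := gcut _ _ xy.
    have CE : C c = C a.
      apply/idP/idP=> [Cc|Ca]; apply: contraT => NC.
        have [E1 E2] := exitC _ _ gca Cc NC.
        by rewrite -E1 -E2 !eqxx orbT in nac.
      have [E1 E2] := exitC _ _ gac Ca NC.
      by rewrite -E1 -E2 !eqxx in nac.
    exists (extend_pred k.+1 (C a) C); rewrite !extend_pred_old //; split=> // u v.
    case/or3P=> [/andP[uv _]|/andP[/eqP->]|/andP[+ /eqP->]].
    * by have [uk vk _] := gdom _ _ uv; rewrite !extend_pred_old //; apply: exitC.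
    * by case/orP=> /eqP->; rewrite extend_pred_new extend_pred_old // ?CE => ->.
    * by case/orP=> /eqP->; rewrite extend_pred_new extend_pred_old // ?CE => ->.
  + case/orP=> /eqP->.
      have [|C [Cp Cq Cm exitC]] := cut_new c a _ true; first by rewrite !eqxx orbT.
      by exists C; rewrite Cm.
    have [|C [Cp Cq Cm exitC]] := cut_new a c _ true; first by rewrite !eqxx.
    by exists C; rewrite Cm.
  + case/orP=> /eqP->.
      have [|C [Cp Cq Cm exitC]] := cut_new a c _ false; first by rewrite !eqxx.
      by exists C; rewrite Cm.
    have [|C [Cp Cq Cm exitC]] := cut_new c a _ false; first by rewrite !eqxx orbT.
    by exists C; rewrite Cm.
Qed.

Lemma valid_nth s k : valid s -> (k < size s)%N ->
  valid_step k.+1 (graph_upto s k) (nth (Free 0) s k).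
Proof. by move=> /allP + ks; apply; rewrite mem_iota. Qed.

Lemma graph_upto_tree s k : valid s -> (k <= size s)%N -> nat_tree k (graph_upto s k).
Proof.
move=> sV; elim: k => [_|k IHk ks]; first exact: nat_tree0.
have := valid_nth sV ks; have {IHk} := IHk (ltnW ks) => /=.
case: (nth _ _ _) => [a|a c] gT /=; first exact: nat_tree_free.
by case/and4P=> ? ? ? ?; apply: nat_tree_sat.
Qed.

Lemma prox_lt s m j : valid s -> (m <= size s)%N -> prox s m j -> (j < m)%N.
Proof.
move=> sV; case: m => [//|m] ms; have := valid_nth sV ms; rewrite /prox.
case: (nth _ _ _) => [a|a c] /=; first by move=> am /eqP->.
by case/and4P=> am cm _ _ /orP[] /eqP->.
Qed.

Lemma prox_exists s m : valid s -> (0 < m <= size s)%N ->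
  exists2 j, (j < m)%N & prox s m j.
Proof.
move=> sV; case: m => [//|m] /= ms; have := valid_nth sV ms; rewrite /prox.
case: (nth _ _ _) => [a|a c] /=; first by exists a.
by case/and4P=> am _ _ _; exists a; rewrite ?eqxx.
Qed.

Definition pcoef (s : seq bstep) (m i : nat) : rat :=
  if m == i then 1 else if prox s m i then -1 else 0.

Lemma pcoef_lt s m i : valid s -> (m <= size s)%N -> (m < i)%N -> pcoef s m i = 0.
Proof.
move=> sV ms mi; rewrite /pcoef ltn_eqF //; case: ifP => // /(prox_lt sV ms).
by rewrite ltnNge ltnW.
Qed.

(** Each blowup adds a row to P. For two distinct old vertices it contributes 1 exactly when the new
    point is proximate to both, cancelling the subdivided edge. The new column is nonzero in that
    row only, so it yields -1 exactly at the components through the new point. *)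
Lemma gram_graph s k i j : valid s -> (k <= size s)%N ->
  (i <= k)%N -> (j <= k)%N -> i != j ->
  \sum_(m < k.+1) pcoef s m i * pcoef s m j = - (graph_upto s k i j)%:R.
Proof.
move=> sV; elim: k i j => [|k IHk] i j ks.
  by rewrite !leqn0 => /eqP-> /eqP->.
have gT := graph_upto_tree sV ks.
have [_ gdom _ _] := graph_upto_tree sV (ltnW ks).
have new l : (l <= k)%N ->
    \sum_(m < k.+2) pcoef s m k.+1 * pcoef s m l = - (graph_upto s k.+1 k.+1 l)%:R.
  move=> lk; rewrite big_ord_recr /= big1 => [|m _]; last first.
    by rewrite pcoef_lt ?mul0r // (leq_trans _ (ltnW ks)) // -ltnS.
  rewrite add0r {1}/pcoef eqxx mul1r /pcoef eq_sym ltn_eqF //=.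
  have gm : graph_upto s k k.+1 l = false.
    by apply/negP=> /gdom[]; rewrite ltnn.
  have lm : (l == k.+1) = false by rewrite ltn_eqF.
  by case: (nth _ _ _) => [a|a c] /=; rewrite gm eqxx lm ?andbF ?orbF /=;
    case: ifP; rewrite ?oppr0.
rewrite leq_eqVlt => /predU1P[->|ik].
  rewrite leq_eqVlt => /predU1P[->|jk _]; [by rewrite eqxx | exact: new].
rewrite leq_eqVlt => /predU1P[->|jk] ij.
  by rewrite (nat_tree_sym gT) -new //; apply: eq_bigr => m _; rewrite mulrC.
have iF : (i == k.+1) = false by rewrite ltn_eqF.
have jF : (j == k.+1) = false by rewrite ltn_eqF.
rewrite big_ord_recr /= IHk // 1?ltnW // /pcoef !(eq_sym k.+1) iF jF /=.
have := valid_nth sV ks; case: (nth _ _ _) => [a|a c] /=.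
  rewrite iF jF /= ?andbF ?orbF => _; case: (eqVneq j a) => [ja|_].
    by rewrite -ja (negPf ij) mul0r addr0.
  by rewrite mulr0 addr0.
case/and4P=> ak ck ac gac; rewrite iF jF /= ?andbF ?orbF.
have gca : graph_upto s k c a by have [gC _ _ _] := graph_upto_tree sV (ltnW ks); rewrite gC.
have [ia|ia] := eqVneq i a.
  have ic : (i == c) = false by rewrite ia (negPf ac).
  have ja : (j == a) = false by rewrite -ia eq_sym (negPf ij).
  rewrite ic ja /= ?andbF ?orbF; have [jc|_] := eqVneq j c.
    by rewrite ia jc gac /=; ring.
  by rewrite ?andbT mulr0 addr0.
have [ic|ic] := eqVneq i c.
  have jc : (j == c) = false by rewrite -ic eq_sym (negPf ij).
  rewrite jc /= ?andbF ?orbF; have [ja|_] := eqVneq j a.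
    by rewrite ic ja gca /=; ring.
  by rewrite ?andbT mulr0 addr0.
by rewrite /= andbT mul0r addr0.
Qed.

(** * Proximity, valuation and intersection matrices *)

Section Blowups.

Variables (n : nat) (s : seq bstep).
Hypotheses (sz : size s = n) (sV : valid s).

Notation P := (Pmx n.+1 s).
Notation Q := (Qmx n.+1 s).
Notation V := (Vmx n.+1 s).
Notation gadj := (@adj n.+1 s).

Let ord_le (i : 'I_n.+1) : (i <= size s)%N.
Proof. by rewrite sz -ltnS. Qed.

Let tree_s : nat_tree n (graph_upto s n).
Proof. by apply: graph_upto_tree; rewrite ?sz. Qed.

Lemma gadjE i j : gadj i j = graph_upto s n i j.
Proof.
rewrite /adj /=; case: eqVneq => //= ->; apply/esym/negP => /(nat_tree_dom tree_s).
by case=> _ _; rewrite eqxx.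
Qed.

Lemma gadjC : symmetric gadj.
Proof. by move=> i j; rewrite !gadjE (nat_tree_sym tree_s). Qed.

Lemma gadj_irr : irreflexive gadj.
Proof. by move=> i; rewrite /adj eqxx. Qed.

Lemma gadj_connected (C : {set 'I_n.+1}) :
  (forall x y, gadj x y -> x \in C -> y \in C) -> forall x y, x \in C -> y \in C.
Proof.
move=> Cstep x y xC.
have := @nat_tree_conn _ _ tree_s (fun z => inord z \in C) _ x y.
rewrite !inord_val; apply=> //; rewrite -1?ltnS // => u v uv.
apply: Cstep; rewrite gadjE; have [un vn _] := nat_tree_dom tree_s uv.
by rewrite !inordK.
Qed.

Lemma gadj_bridge x y : gadj x y -> exists C : {set 'I_n.+1},
  [/\ x \in C, y \notin C &
      forall u v, gadj u v -> u \in C -> v \notin C -> u = x /\ v = y].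
Proof.
rewrite gadjE => /(nat_tree_cut tree_s)[C [Cx Cy exitC]].
exists [set i : 'I_n.+1 | C i]; rewrite !inE; split=> // u v.
rewrite gadjE !inE => uv Cu Cv; have [] := exitC _ _ uv Cu Cv.
by split; apply: val_inj.
Qed.

Lemma PmxE i j : P i j = pcoef s i j.
Proof. by rewrite mxE. Qed.

Lemma Pmx_unit : P \in unitmx.
Proof.
rewrite unitmxE det_trig; last first.
  by apply/is_trig_mxP => i j ij; rewrite PmxE pcoef_lt.
by rewrite big1 ?unitr1 // => i _; rewrite mxE eqxx.
Qed.

Lemma Qmx_rec i j : Q i j = (i == j)%:R + \sum_(m < n.+1 | prox s i m) Q m j.
Proof.
have := congr1 (fun A : 'M_n.+1 => A i j) (mulmxV Pmx_unit).
rewrite !mxE (bigD1 i) //= mxE eqxx mul1r => <-.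
suff -> : \sum_(m < n.+1 | m != i) P i m * Q m j = - \sum_(m < n.+1 | prox s i m) Q m j.
  by rewrite addrNK.
rewrite -sumrN [LHS]big_mkcond [RHS]big_mkcond; apply: eq_bigr => m _ /=.
rewrite PmxE /pcoef -val_eqE /= eq_sym; case: eqVneq => [im|_].
  by case: ifP => // /(prox_lt sV (ord_le i)); rewrite im ltnn.
by case: ifP; rewrite ?mulN1r ?mul0r.
Qed.

Lemma Qmx_nat i j : Q i j \is a Num.nat.
Proof.
have [k ik] := ubnP (val i); elim: k i ik => // k IHk i ik.
rewrite Qmx_rec rpredD ?rpred_nat ?rpred_sum // => m /(prox_lt sV (ord_le i)) mi.
by apply: IHk; apply: leq_trans mi _.
Qed.

Lemma Qmx_ge0 i j : 0 <= Q i j.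
Proof. by have := Qmx_nat i j; rewrite natrEint => /andP[]. Qed.

(** Every later point is proximate to an earlier one, so positivity propagates from the first point.
    This makes all entries of V positive. *)
Lemma Qmx_gt0 i : 0 < Q i ord0.
Proof.
have [k ik] := ubnP (val i); elim: k i ik => // k IHk i ik.
rewrite Qmx_rec; case: (eqVneq i ord0) => [_|i0].
  by rewrite ltr_wpDr ?sumr_ge0 // => m _; apply: Qmx_ge0.
have /(prox_exists sV)[a ai ia] : (0 < i <= size s)%N.
  by rewrite ord_le andbT lt0n.
have an : (a < n.+1)%N by apply: ltn_trans ai (ltn_ord i).
rewrite add0r (bigD1 (Ordinal an)) //= ltr_wpDr ?sumr_ge0 // => [m _|].
  exact: Qmx_ge0.
by apply: IHk; apply: leq_trans ai _.
Qed.

Lemma gram_unit : P^T *m P \in unitmx.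
Proof. by rewrite unitmx_mul unitmx_tr Pmx_unit. Qed.

Lemma VmxE : V = Q *m Q^T.
Proof.
rewrite /Vmx -[RHS](mulKmx gram_unit) -[X in _ = _ *m X]mulmxA (mulmxA P) mulmxV ?Pmx_unit //.
by rewrite mul1mx -trmx_mul mulVmx ?Pmx_unit // trmx1 mulmx1.
Qed.

Lemma Vmx_int i j : V i j \is a Num.int.
Proof.
rewrite VmxE mxE rpred_sum // => m _; rewrite mxE.
by have := rpredM (Qmx_nat i m) (Qmx_nat j m); rewrite natrEint => /andP[].
Qed.

Lemma Vmx_gt0 i j : 0 < V i j.
Proof.
rewrite VmxE mxE (bigD1 ord0) //= mxE ltr_wpDr ?mulr_gt0 ?Qmx_gt0 //.
by apply: sumr_ge0 => m _; rewrite mxE mulr_ge0 ?Qmx_ge0.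
Qed.

Lemma VmxC i j : V i j = V j i.
Proof.
by rewrite VmxE !mxE; apply: eq_bigr => m _; rewrite !mxE mulrC.
Qed.

Definition weight (i : 'I_n.+1) : rat := \sum_m P m i ^+ 2.

Notation glap := (lap gadj weight).

Lemma gramE i j : (P^T *m P) i j = if i == j then weight i else - (gadj i j)%:R.
Proof.
rewrite mxE; under eq_bigr => m _ do rewrite mxE.
case: eqVneq => [->|ij]; first by apply: eq_bigr => m _; rewrite expr2.
under eq_bigr => m _ do rewrite !PmxE.
by rewrite gram_graph ?gadjE ?sz // -ltnS.
Qed.

Lemma gram_lap a i : \sum_j (P^T *m P) i j * a j = glap a i.
Proof.
rewrite (bigD1 i) //= gramE eqxx /lap; congr (_ + _).
rewrite -sumrN [LHS]big_mkcond [RHS]big_mkcond; apply: eq_bigr => j _ /=.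
rewrite gramE eq_sym; case: eqVneq => [->|_]; first by rewrite gadj_irr.
by case: (gadj i j); rewrite ?mulN1r // oppr0 mul0r.
Qed.

Lemma gramC i j : (P^T *m P) i j = (P^T *m P) j i.
Proof. by rewrite !gramE eq_sym gadjC; case: eqVneq => // ->. Qed.

Lemma weight_int i : weight i \is a Num.int.
Proof.
apply: rpred_sum => m _; rewrite rpredX // PmxE /pcoef.
by case: eqP => // _; case: ifP => _; rewrite ?rpredN ?rpred1 ?rpred0.
Qed.

Lemma lap_Vmx i j : glap (V j) i = (i == j)%:R.
Proof.
have := congr1 (fun A : 'M_n.+1 => A i j) (mulmxV gram_unit).
rewrite !mxE => <-; rewrite -gram_lap; apply: eq_bigr => l _.
by rewrite VmxC.
Qed.

(** The sum of the [a j * glap a j] is the squared norm of P a, and P is invertible. *)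
Lemma glap_definite a : (forall j, a j * glap a j = 0) -> forall j, a j = 0.
Proof.
move=> a0; pose x := \col_j a j.
have Px0 : P *m x = 0.
  apply/colP => m; rewrite [RHS]mxE.
  have S0 : \sum_k ((P *m x) k 0) ^+ 2 = 0.
    transitivity (\sum_j a j * glap a j); last by apply: big1.
    transitivity ((x^T *m (P^T *m P *m x)) 0 0).
      rewrite mulmxA mulmxA -mulmxA -trmx_mul mxE; apply: eq_bigr => k _.
      by rewrite [X in _ = X * _]mxE expr2.
    rewrite mxE; apply: eq_bigr => j _; rewrite [x^T _ _]mxE [x _ _]mxE; congr (_ * _).
    by rewrite mxE -gram_lap; apply: eq_bigr => l _; rewrite [x _ _]mxE.
  have := psumr_eq0P _ S0 (i := m) => /(_ (fun _ _ => sqr_ge0 _) isT)/eqP.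
  by rewrite sqrf_eq0 => /eqP.
move=> j; have := mulKmx Pmx_unit x; rewrite Px0 mulmx0 => /colP/(_ j).
by rewrite !mxE.
Qed.

(** Adjunction. As k = Q 1, the product P^T P k consists of the column sums of P. Adding [weight i],
    each entry p of column i contributes p + p^2, which is 2 on the diagonal and 0 elsewhere. *)
Lemma lap_log_discrepancy i :
  glap (fun j => kcoef s j + 1) i = 2 - (degree gadj i)%:R.
Proof.
have kE j : kcoef s j = (Q *m const_mx 1 : 'cV_n.+1) j 0.
  by rewrite mxE; apply: eq_bigr => m _; rewrite mxE mulr1.
have Pk : \sum_j (P^T *m P) i j * kcoef s j = \sum_m P m i.
  under eq_bigr => j _ do rewrite kE.
  transitivity ((P^T *m P *m (Q *m const_mx 1 : 'cV_n.+1)) i 0); first by rewrite [RHS]mxE.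
  rewrite -mulmxA (mulmxA P) mulmxV ?Pmx_unit // mul1mx mxE.
  by apply: eq_bigr => m _; rewrite !mxE mulr1.
have -> : glap (fun j => kcoef s j + 1) i = \sum_m P m i + glap (fun=> 1) i.
  rewrite -Pk -!gram_lap -big_split; apply: eq_bigr => j _ /=.
  by rewrite mulrDr.
rewrite /lap -degreeE mulr1 addrA; congr (_ - _); rewrite /weight -big_split /=.
rewrite (bigD1 i) //= big1 => [|m mi]; first by rewrite mxE eqxx; ring.
by rewrite mxE (negPf mi); case: ifP => _; ring.
Qed.

End Blowups.

(** * Jumping numbers supported at a vertex *)

Section JumpingNumbers.

Variables (n : nat) (s : seq bstep) (dhat : 'I_n.+1 -> nat) (mu : 'I_n.+1) (xi : rat).
Hypotheses (sz : size s = n) (sV : valid s).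
Hypotheses (dhat_neq0 : exists i, dhat i != 0%N) (xi_gt0 : 0 < xi).

Notation gadj := (@adj n.+1 s).
Notation V := (Vmx n.+1 s).
Notation gabove := (above gadj (weight (n:=n) s) (fun i j => V i j) dhat xi).

Lemma fhat_lap f i : fhat s f i = lap gadj (weight s) f i.
Proof.
rewrite -(gram_lap sz sV) /fhat /Vmx invmxK; apply: eq_bigr => j _.
by rewrite (gramC sz sV) mulrC.
Qed.

Lemma kcoef_int (i : 'I_n.+1) : kcoef s i \is a Num.int.
Proof. by apply: rpred_sum => m _; rewrite intrEge0 ?Qmx_ge0 ?Qmx_nat. Qed.

Lemma dcoef_gt0 i : 0 < dcoef s dhat i.
Proof.
have [j dj] := dhat_neq0; rewrite /dcoef (bigD1 j) //= ltr_wpDr //.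
  by apply: sumr_ge0 => l _; rewrite mulr_ge0 ?ler0n // ltW ?Vmx_gt0.
by rewrite mulr_gt0 ?Vmx_gt0 // ltr0n lt0n.
Qed.

Lemma lap_shift f i :
  lap gadj (weight s) (fun j => 1 * f j + 1 * (kcoef s j + 1)) i =
  fhat s f i + (2 - (degree gadj i)%:R).
Proof. by rewrite lap_linear lap_log_discrepancy // fhat_lap !mul1r. Qed.

(* The substitution a = f + k + 1. *)
Lemma jumping_atP : jumping_at s dhat mu xi <->
  exists a, (forall j, gabove a j) /\ a mu = xi * dvec (fun i j => V i j) dhat mu.
Proof.
have dE j : dvec (fun i j => V i j) dhat j = dcoef s dhat j by [].
split=> [[f [[f_int f_ge0] [xiE lam_min]]]|[a [aA amu]]].
  exists (fun j => 1 * f j + 1 * (kcoef s j + 1)).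
  have lamE j : lam s dhat f j * dcoef s dhat j = f j + kcoef s j + 1.
    by rewrite /lam divfK // gt_eqF // dcoef_gt0.
  split=> [j|]; last by rewrite dE xiE lamE; ring.
  split; first by rewrite !mul1r !rpredD ?kcoef_int ?rpred1.
    rewrite dE !mul1r addrA -lamE ler_pM2r ?dcoef_gt0 //.
    by rewrite xiE lam_min.
  by rewrite lap_shift lerDr f_ge0.
pose f j := a j - kcoef s j - 1.
have lamE j : lam s dhat f j = a j / dcoef s dhat j.
  by rewrite /lam /f; congr (_ / _); ring.
have lam_mu : lam s dhat f mu = xi by rewrite lamE amu dE mulfK // gt_eqF // dcoef_gt0.
exists f; split; first split=> j.
- by have [a_int _ _] := aA j; rewrite !rpredB ?kcoef_int ?rpred1.
- have [_ _] := aA j; have -> : lap gadj (weight s) a j = fhat s f j + (2 - (degree gadj j)%:R).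
    by rewrite -lap_shift; apply: eq_lap => l; rewrite /f; ring.
  by rewrite lerDr.
- split=> [//|j]; rewrite lam_mu lamE ler_pdivlMr ?dcoef_gt0 //.
  by case: (aA j).
Qed.

Lemma hfunE : hfun s dhat mu xi = hval gadj (fun i j => V i j) dhat xi mu.
Proof. by []. Qed.

End JumpingNumbers.

Theorem mainTheorem1 (N : nat) (s : seq bstep) (dhat : 'I_N -> nat)
    (mu : 'I_N) (xi : rat) :
  size s = N.-1 -> valid s -> (exists i, dhat i != 0%N) -> 0 < xi ->
  (@jumping_at N s dhat mu xi <->
   exists n : nat, @in_S N s mu n /\ @hfun N s dhat mu xi = n%:R).
Proof.
(* For [N = 0] there is no vertex [mu]. *)
case: N dhat mu => [dhat [] //|n] dhat mu /= sz sV dhat_neq0 xi_gt0.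
rewrite jumping_atP // hfunE.
split=> [[a [aA amu]]|[m [[c ->] hE]]].
  have [c hE] := hval_of_above (gadjC sz sV) (@gadj_irr n s) (gadj_connected sz sV)
    (gadj_bridge sz sV) (weight_int s) (Vmx_int sz sV) (Vmx_gt0 sz sV)
    (VmxC sz sV) (lap_Vmx sz sV) (glap_definite sz sV) xi_gt0 aA amu.
  by exists (\sum_v c v * sgen s mu v)%N; split; first by exists c.
exact: (above_of_hval (gadjC sz sV) (@gadj_irr n s) (gadj_connected sz sV)
  (gadj_bridge sz sV) (weight_int s) (Vmx_int sz sV) (Vmx_gt0 sz sV)
  (VmxC sz sV) (lap_Vmx sz sV) (glap_definite sz sV) xi_gt0 hE).
Qed.
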